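(* Let $Q=(q_{ij})_{i,j\in[k]}$ be a symmetric $k\times k$ matrix with non-negative entries, and let $\mathbf x=(x_1,\dots,x_k)^T\in[0,\infty)^k$. Then: (a) If $\mathbf x'\in[0,\infty)^k$ and $\mathbf x'\preceq s\mathbf x$ for some $s>0$, then $w(\mathbf x')\le s\,w(\mathbf x)$ and $w_*(\mathbf x')\le s\,w_*(\mathbf x)$. In particular $w(s\mathbf x)=s\,w(\mathbf x)$ and $w_*(s\mathbf x)=s\,w_*(\mathbf x)$. (b) There is $\mathbf z=(z_1,\dots,z_k)^T$ with $z_i\in\{0,x_i\}$ for all $i$ such that $\frac{\mathbf z^TQ\mathbf z}{\|\mathbf z\|}=w(\mathbf x)$. (c) If $\mathbf y^TQ\mathbf y\ge0$ for all $\mathbf y\in\mathbb R^k$ with $\sum_iy_i=0$, then $w(\mathbf x)=w_*(\mathbf x)$. (d) $q^*\|\mathbf x\|\ge\hat q(\mathbf x)\|\mathbf x\|\ge w_*(\mathbf x)$, and if additionally $q^*>0$ then $w_*(\mathbf x)\ge\frac{(\hat q(\mathbf x))^2}{\sum_{i\in[k]}q_{ii}}\|\mathbf x\|\ge\frac{(\hat q(\mathbf x))^2}{kq^*}\|\mathbf x\|$. (e) For any $\mathbf x'\in[0,\infty)^k$, $w_*(\mathbf x)+w_*(\mathbf x')\ge w_*(\mathbf x+\mathbf x')$. (f) There exist $\mathbf x^{(1)},\dots,\mathbf x^{(k)}\in[0,\infty)^k$ with $\sum_{t\in[k]}\mathbf x^{(t)}=\mathbf x$ and $\sum_{t\in[k]}w(\mathbf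 x^{(t)})=w_*(\mathbf x)$. (g) If $\mathbf x\in\mathbb N^k$, then there exist $\mathbf x^{(1)},\dots,\mathbf x^{(k)}\in\mathbb N^k$ with $\sum_{t\in[k]}\mathbf x^{(t)}=\mathbf x$ and $\sum_{t\in[k]}w(\mathbf x^{(t)})\le w_*(\mathbf x)+k^2q^*$.
   Context: $\|\mathbf x\|=|x_1|+\dots+|x_k|$. For $\mathbf x,\mathbf y\in\mathbb R^k$, $\mathbf y\preceq\mathbf x$ means $\mathbf x-\mathbf y\in[0,\infty)^k$. For $\mathbf x\in[0,\infty)^k$: $w(\mathbf x)=w(\mathbf x,Q)=\max_{\mathbf 0\preceq\mathbf y\preceq\mathbf x}\frac{\mathbf y^TQ\mathbf y}{\|\mathbf y\|}$, where the ratio is taken to be $0$ at $\mathbf y=\mathbf 0$ (and similarly $\frac{\mathbf z^TQ\mathbf z}{\|\mathbf z\|}=0$ if $\mathbf z=\mathbf 0$); $w_*(\mathbf x)=w_*(\mathbf x,Q)=\inf_{\mathcal S}\sum_{\mathbf y\in\mathcal S}w(\mathbf y)$ over all finite systems $\mathcal S$ of vectors in $[0,\infty)^k$ with $\sum_{\mathbf y\in\mathcal S}\mathbf y=\mathbf x$. $q^*=\max_{i\in[k]}q_{ii}$; $\hat q(\mathbf x)=\frac{\sum_ix_iq_{ii}}{\|\mathbf x\|}$ for $\mathbf x\ne\mathbf 0$ and $\hat q(\mathbf 0)=q^*$. In (g), $\mathbb N=\{0,1,2,\dots\}$. *)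

(* Defs.v *)
From HB Require Import structures.
From mathcomp Require Import all_boot all_order all_algebra.
From mathcomp Require Import all_classical all_reals.

Set Implicit Arguments.
Unset Strict Implicit.
Unset Printing Implicit Defensive.

Import Order.TTheory GRing.Theory Num.Theory.

Local Open Scope classical_set_scope.
Local Open Scope ring_scope.

Section Defs.
Variables (R : realType) (k : nat).
Implicit Types (Q : 'M[R]_k) (x y : 'cV[R]_k).

Definition nonnegv x : Prop := forall i, 0 <= x i 0.

Definition natv x : Prop := forall i, x i 0 \is a Num.nat.

Definition preceqv y x : Prop := nonnegv (x - y).

(* The library norm on matrices is the sup norm, hence this definition. *)
Definition norm1 x : R := \sum_i `|x i 0|.

Definition qform Q y : R := (y^T *m Q *m y) 0 0.

(* Equal to 0 at y = 0, since division by 0 yields 0. *)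
Definition qratio Q y : R := qform Q y / norm1 y.

(* The maximum is expressed as the supremum of the set of values. *)
Definition w Q x : R :=
  sup [set qratio Q y | y in [set y | preceqv 0 y /\ preceqv y x]].

(* A finite system is a sequence, so that repeated vectors are allowed. *)
Definition systems x : set (seq 'cV[R]_k) :=
  [set S | (forall y, y \in S -> nonnegv y) /\ \sum_(y <- S) y = x].

Definition wstar Q x : R := inf [set \sum_(y <- S) w Q y | S in systems x].

(* The default value 0 is harmless: it is used for Q with entries >= 0 only. *)
Definition qstar Q : R := \big[Num.max/0]_i Q i i.

Definition qhat Q x : R :=
  if x == 0 then qstar Q else (\sum_i x i 0 * Q i i) / norm1 x.

End Defs.

(* Main.v *)
Require Import Defs.
From HB Require Import structures.
From mathcomp Require Import all_boot all_order all_algebra.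
From mathcomp Require Import all_classical all_reals.
From mathcomp Require Import topology normedtype lra.

Set Implicit Arguments.
Unset Strict Implicit.
Unset Printing Implicit Defensive.

Import Order.TTheory GRing.Theory Num.Theory.
Import numFieldNormedType.Exports.

Local Open Scope ring_scope.

(* For nonnegative [y], [qratio Q y <= c] means [qform Q y <= c * norm1 y], and
   the difference of the two sides is convex in each coordinate, so the maximum
   defining [w] is attained at a vertex of the box.  Monotonicity and positive
   homogeneity of [w] then do most of the work.  The conditional positivity
   in (c) makes [qratio Q] subadditive.  The lower bound in (d) follows from
   bounding [w] below by a linear function that depends on [x].  For (f), a
   system of more than [k] vectors is linearly dependent and one of them can be
   removed without increasing the total of [w]; a minimum over systems of [k]
   vectors exists by compactness.  For (g), apply (f) to [x + k (1, ..., 1)] and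
   round all entries down. *)

(** * The quadratic form, the norm and the vertices of a box *)

Section QuadraticForm.
Variables (R : realType) (k : nat).
Implicit Types (Q : 'M[R]_k) (x y u v : 'cV[R]_k) (A : {set 'I_k}).

Lemma qformE Q y : qform Q y = \sum_i \sum_j y i 0 * Q i j * y j 0.
Proof.
rewrite /qform mxE exchange_big; apply: eq_bigr => j _.
by rewrite mxE big_distrl; apply: eq_bigr => i _; rewrite mxE.
Qed.

(** The mixed term is written as [qform Q u + qform Q v - qform Q (u - v)], so that convexity and
    subadditivity arguments involve only values of the form itself. *)
Lemma qform_lin Q (a b : R) u v :
  qform Q (a *: u + b *: v) =
    a ^+ 2 * qform Q u + b ^+ 2 * qform Q v
    + a * b * (qform Q u + qform Q v - qform Q (u - v)).
Proof.
rewrite !qformE !pair_big /=.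
rewrite -big_split -sumrB !mulr_sumr -!big_split /=.
by apply: eq_bigr => -[i j] _; rewrite !mxE /=; lra.
Qed.

Lemma qformZ Q (a : R) u : qform Q (a *: u) = a ^+ 2 * qform Q u.
Proof. by rewrite -[a *: u]addr0 -(scale0r u) qform_lin; lra. Qed.

Lemma qform0 Q : qform Q 0 = 0.
Proof. by rewrite -(scale0r 0) qformZ expr0n mul0r. Qed.

Lemma qform_ge0 Q y :
  (forall i j, 0 <= Q i j) -> nonnegv y -> 0 <= qform Q y.
Proof.
move=> Q0 y0; rewrite qformE.
by apply: sumr_ge0 => i _; apply: sumr_ge0 => j _; rewrite !mulr_ge0.
Qed.

Lemma norm1_nonneg y : nonnegv y -> norm1 y = \sum_i y i 0.
Proof. by move=> y0; apply: eq_bigr => i _; rewrite ger0_norm. Qed.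

Lemma norm1_ge0 y : 0 <= norm1 y.
Proof. exact: sumr_ge0. Qed.

Lemma norm1_eq0 y : (norm1 y == 0) = (y == 0).
Proof.
rewrite /norm1 psumr_eq0 //; apply/allP/eqP => [y0 | -> i _]; last first.
  by rewrite mxE normr0 eqxx.
apply/matrixP => i j; rewrite ord1 mxE.
by have /eqP/normr0_eq0 := y0 i (mem_index_enum i).
Qed.

Lemma nonneg0 : nonnegv (0 : 'cV[R]_k).
Proof. by move=> i; rewrite mxE. Qed.

Lemma nonnegD x y : nonnegv x -> nonnegv y -> nonnegv (x + y).
Proof. by move=> x0 y0 i; rewrite mxE addr_ge0. Qed.

Lemma nonnegZ (s : R) x : 0 <= s -> nonnegv x -> nonnegv (s *: x).
Proof. by move=> s0 x0 i; rewrite mxE mulr_ge0. Qed.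

Lemma nonneg_sum (I : Type) (r : seq I) (P : pred I) (F : I -> 'cV[R]_k) :
  (forall i, P i -> nonnegv (F i)) -> nonnegv (\sum_(i <- r | P i) F i).
Proof. by move=> F0; apply: big_ind => //; [exact: nonneg0 | exact: nonnegD]. Qed.

Lemma preceqP y x : preceqv y x <-> forall i, y i 0 <= x i 0.
Proof. by split=> yx i; have := yx i; rewrite !mxE subr_ge0. Qed.

Lemma preceq0P y : preceqv 0 y <-> nonnegv y.
Proof. by rewrite /preceqv subr0. Qed.

Lemma norm1D x y : nonnegv x -> nonnegv y -> norm1 (x + y) = norm1 x + norm1 y.
Proof.
move=> x0 y0; rewrite !norm1_nonneg //; last exact: nonnegD.
by rewrite -big_split; apply: eq_bigr => i _; rewrite mxE.
Qed.

Lemma norm1Z (s : R) y : norm1 (s *: y) = `|s| * norm1 y.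
Proof. by rewrite /norm1 mulr_sumr; apply: eq_bigr => i _; rewrite mxE normrM. Qed.

Lemma qratioM Q y : qratio Q y * norm1 y = qform Q y.
Proof.
have [->|y0] := eqVneq y 0; last by rewrite /qratio divfK ?norm1_eq0.
by rewrite qform0 /qratio qform0 !mul0r.
Qed.

(** At [y = 0] the left inequality reads [0 <= c], hence the condition on [c]; elsewhere a positive
    denominator is cleared. *)
Lemma qratio_le Q y (c : R) :
  0 <= c -> (qratio Q y <= c) = (qform Q y <= c * norm1 y).
Proof.
move=> c0; have [->|y0] := eqVneq y 0.
  have /eqP n0 : norm1 (0 : 'cV[R]_k) == 0 by rewrite norm1_eq0.
  by rewrite /qratio qform0 n0 mul0r mulr0 lexx c0.
by rewrite /qratio ler_pdivrMr // lt_def norm1_ge0 norm1_eq0 y0.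
Qed.

Lemma qratioZ Q (s : R) y : 0 < s -> qratio Q (s *: y) = s * qratio Q y.
Proof.
move=> s0; rewrite /qratio qformZ norm1Z gtr0_norm // invfM.
by rewrite mulrACA expr2 mulfK ?gt_eqF.
Qed.

Lemma qratio_ge0 Q y :
  (forall i j, 0 <= Q i j) -> nonnegv y -> 0 <= qratio Q y.
Proof. by move=> Q0 y0; rewrite divr_ge0 ?qform_ge0 ?norm1_ge0. Qed.

(** For nonnegative [x] these are the vertices of the box between [0] and [x]. *)
Definition restr A x : 'cV[R]_k := \col_i (if i \in A then x i 0 else 0).

Lemma restrD A x y : restr A (x + y) = restr A x + restr A y.
Proof. by apply/matrixP => i j; rewrite !mxE; case: ifP => _; rewrite ?addr0 ?mxE. Qed.

Lemma restr_nonneg A x : nonnegv x -> nonnegv (restr A x).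
Proof. by move=> x0 i; rewrite mxE; case: ifP. Qed.

Lemma restr_le A x : nonnegv x -> preceqv (restr A x) x.
Proof. by move=> x0; apply/preceqP => i; rewrite mxE; case: ifP. Qed.

Definition upd y (i : 'I_k) (a : R) : 'cV[R]_k :=
  \col_j (if j == i then a else y j 0).

(* [qform Q y - c * norm1 y] is convex in each coordinate separately, since
   the diagonal of [Q] is nonnegative; so it is maximal at a vertex. *)
Lemma qform_le_vertices Q x (c : R) :
  (forall i, 0 <= Q i i) -> nonnegv x ->
  (forall A, qform Q (restr A x) <= c * norm1 (restr A x)) ->
  forall y, nonnegv y -> preceqv y x -> qform Q y <= c * norm1 y.
Proof.
move=> Q0 x0 vert y.
(* Induction on the number of coordinates of [y] that are at neither end of their interval. *)
have [n] := ubnP #|[set i | (y i 0 != 0) && (y i 0 != x i 0)]|.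
elim: n y => // n IHn y; rewrite ltnS => yn y0 yx.
have [E|[i]] := set_0Vmem [set i | (y i 0 != 0) && (y i 0 != x i 0)].
  suff -> : y = restr [set i | y i 0 == x i 0] x by [].
  apply/matrixP => i j; rewrite ord1 !mxE inE.
  case: eqP => // /eqP yxi; apply/eqP.
  by move/finset.setP/(_ i): E; rewrite !inE yxi andbT => /negbFE.
move=> iD; have := iD; rewrite inE => /andP[yi0 yix].
have yle : y i 0 <= x i 0 by move/preceqP: yx.
have yip : 0 < y i 0 by rewrite lt_def yi0 y0.
have xip : 0 < x i 0 by apply: lt_le_trans yle.
have step a : a = 0 \/ a = x i 0 ->
    nonnegv (upd y i a) /\ qform Q (upd y i a) <= c * norm1 (upd y i a).
  move=> aE.
  have u0 : nonnegv (upd y i a).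
    by move=> j; rewrite mxE; case: eqP => // _; case: aE => ->.
  split=> //; apply: IHn => //; last first.
    apply/preceqP => j; rewrite mxE; case: eqP => [->|_].
      by case: aE => ->.
    by move/preceqP: yx.
  apply: leq_trans yn; apply: proper_card; apply/properP; split.
    apply/fintype.subsetP => j; rewrite !inE mxE; have [->|//] := eqVneq j i.
    by case: aE => ->; rewrite eqxx ?andbF.
  by exists i => //; rewrite inE mxE eqxx; case: aE => ->; rewrite eqxx ?andbF.
have [u0 hu] := step 0 (or_introl erefl).
have [v0 hv] := step (x i 0) (or_intror erefl).
set u := upd y i 0 in u0 hu; set v := upd y i (x i 0) in v0 hv.
(* [y] lies on the segment from [u] to [v], at parameter [t]. *)
pose t := y i 0 / x i 0.
have t0 : 0 <= t by rewrite divr_ge0 // ltW.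
have t1 : t <= 1 by rewrite ler_pdivrMr // mul1r.
have yE : y = (1 - t) *: u + t *: v.
  apply/matrixP => j j'; rewrite ord1 !mxE; have [->|_] := eqVneq j i; last lra.
  by rewrite mulr0 add0r divfK ?gt_eqF.
(* [u - v] is supported on coordinate [i], so its form is [Q i i] times a square. *)
have duv : 0 <= qform Q (u - v).
  rewrite qformE (bigD1 i) //= (bigD1 i) //= !big1 => [||j ji].
  - by rewrite addr0 addr0 mulrAC mulr_ge0 // -expr2 sqr_ge0.
  - by move=> j ji; apply: big1 => l _; rewrite !mxE (negPf ji) subrr !mul0r.
  - by rewrite !mxE (negPf ji) subrr mulr0.
have nE : norm1 y = (1 - t) * norm1 u + t * norm1 v.
  by rewrite {1}yE norm1D; try apply: nonnegZ; rewrite ?norm1Z ?ger0_norm ?subr_ge0.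
rewrite nE [in qform Q y]yE qform_lin.
move: (qform Q (u - v)) duv (qform Q u) hu (qform Q v) hv => d d0 a ha b hb.
have h1 : 0 <= t * (1 - t) * d by do 2 apply: mulr_ge0 => //; rewrite subr_ge0.
have h2 := ler_wpM2l t0 hb.
have h3 : (1 - t) * a <= (1 - t) * (c * norm1 u).
  by rewrite ler_wpM2l // subr_ge0.
move: (norm1 u) (norm1 v) h1 h2 h3 => nu nv.
by clear -t; clearbody t; lra.
Qed.

End QuadraticForm.
(** As [e] decreases to 0, the points of the box satisfying [P e] form a filter base, which has a
    cluster point [p] by Tychonoff's theorem. The conclusion gives approximants of [p] rather than
    [P 0 p], since a limit of such points may fail [P]. *)
Lemma box_approx (R : realType) (I : finType) (a : I -> R)
    (P : R -> (I -> R) -> Prop) :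
  (forall e e' f, e <= e' -> P e f -> P e' f) ->
  (forall e, 0 < e -> exists2 f, P e f & forall i, 0 <= f i <= a i) ->
  exists p, forall e, 0 < e ->
    exists f, [/\ P e f, forall i, 0 <= f i & forall i, `|p i - f i| < e].
Proof.
move=> Pmono Pex.
pose B e := [set f : I -> R | P e f /\ forall i, 0 <= f i <= a i]%classic.
pose F := filter_from [set e : R | 0 < e]%classic B.
have FF : Filter F.
  apply: filter_from_filter; first by exists 1; exact: ltr01.
  move=> e e' e0 e'0; exists (Num.min e e'); first by rewrite /= lt_min e0.
  by move=> f [Pf f0]; split; split=> //; apply: Pmono Pf; rewrite ge_min lexx ?orbT.
have PF : ProperFilter F.
  apply: filter_from_proper => e /= e0.
  by have [f Pf f0] := Pex e e0; exists f.
have [|p [_ clp]] := @tychonoff I (fun=> R) (fun i => `[0, a i]%classic)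
  (fun i => @segment_compact R 0 (a i)) F PF.
  exists 1 => //= f [_ f0] i; have := f0 i.
  by rewrite /= in_itv.
exists p => e e0.
have Fe : F (B e) by exists e.
have Np : nbhs p [set f : I -> R | forall i, `|p i - f i| < e]%classic.
  apply: (@filter_forall _ _ (fun i f => `|p i - f i| < e) (nbhs p)) => i.
  exact: (@proj_continuous I (fun=> R) i p _ (nbhsx_ballx (p i) e e0)).
have [f [[Pf f0] fp]] := clp _ _ Fe Np.
by exists f; split=> // i; have /andP[] := f0 i.
Qed.

(** * Attainment, monotonicity, homogeneity and subadditivity of [w] and [wstar] *)

Section W.
Variables (R : realType) (k : nat) (Q : 'M[R]_k).
Hypothesis Qge0 : forall i j, 0 <= Q i j.
Implicit Types (x y u v : 'cV[R]_k) (A : {set 'I_k}) (S : seq 'cV[R]_k).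

(** The largest ratio over the vertices bounds the ratio on the whole box by [qform_le_vertices], so
    the supremum is attained there. Later arguments use only these two facts about [w]. *)
Lemma w_vertex x : nonnegv x ->
  (exists A, w Q x = qratio Q (restr A x)) /\
  (forall y, nonnegv y -> preceqv y x -> qratio Q y <= w Q x).
Proof.
move=> x0.
have [A _ Amax] := @arg_maxP _ _ _ (finset.set0 : {set 'I_k}) predT
  (fun A => qratio Q (restr A x)) isT.
set c := qratio Q (restr A x).
have c0 : 0 <= c by apply: qratio_ge0 => //; exact: restr_nonneg.
have ub y : nonnegv y -> preceqv y x -> qratio Q y <= c.
  move=> y0 yx; rewrite qratio_le //.
  apply: (qform_le_vertices _ x0) => // B; rewrite -qratio_le //.
  exact: Amax.
suff wE : w Q x = c by split; [exists A | rewrite wE].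
set E := [set qratio Q y | y in [set y | preceqv 0 y /\ preceqv y x]]%classic.
have Ec : E c.
  exists (restr A x) => //; split; last exact: restr_le.
  by apply/preceq0P; exact: restr_nonneg.
have ubE : ubound E c by move=> _ [y [/preceq0P y0 yx] <-]; exact: ub.
apply/eqP; rewrite eq_le; apply/andP; split.
  by apply: ge_sup => //; exists c.
by apply: ub_le_sup => //; exists c.
Qed.

Lemma qratio_le_w y x : nonnegv y -> preceqv y x -> qratio Q y <= w Q x.
Proof.
move=> y0 yx; apply: (w_vertex _).2 => // i.
by apply: le_trans (y0 i) _; move/preceqP: yx.
Qed.

Lemma w_ge0 x : nonnegv x -> 0 <= w Q x.
Proof.
move=> x0; have [[A ->] _] := w_vertex x0.
by apply: qratio_ge0 => //; exact: restr_nonneg.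
Qed.

(** Dividing an optimal vertex for [x'] by [s] gives a vector below [x], and the ratio is
    homogeneous of degree one. *)
Lemma w_le_scale x x' (s : R) : nonnegv x -> nonnegv x' -> 0 < s ->
  preceqv x' (s *: x) -> w Q x' <= s * w Q x.
Proof.
move=> x0 x'0 s0 /preceqP x'x; have [[A ->] _] := w_vertex x'0.
rewrite -ler_pdivrMl // -qratioZ ?invr_gt0 //.
apply: qratio_le_w.
  by apply: nonnegZ; [rewrite invr_ge0 ltW | exact: restr_nonneg].
apply/preceqP => i; rewrite !mxE ler_pdivrMl //.
by case: ifP => _; [have := x'x i; rewrite mxE | rewrite mulr_ge0 // ltW].
Qed.

Lemma w_le x x' : nonnegv x' -> preceqv x' x -> w Q x' <= w Q x.
Proof.
move=> x'0 x'x; rewrite -[leRHS]mul1r; apply: w_le_scale => //; rewrite ?scale1r //.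
by move=> i; apply: le_trans (x'0 i) _; move/preceqP: x'x.
Qed.

Lemma w0 : w Q 0 = 0.
Proof.
have [[A ->] _] := w_vertex (@nonneg0 R k).
have -> : restr A 0 = 0 :> 'cV[R]_k by apply/matrixP => i j; rewrite !mxE if_same.
by rewrite /qratio qform0 mul0r.
Qed.

(** Apply [w_le_scale] with [s] and with its inverse. The case [s = 0] is included because
    [drop_vector] rescales by coefficients that may vanish. *)
Lemma wZ (s : R) x : nonnegv x -> 0 <= s -> w Q (s *: x) = s * w Q x.
Proof.
move=> x0; rewrite le_eqVlt => /predU1P[<-|s0]; first by rewrite scale0r w0 mul0r.
have sx0 : nonnegv (s *: x) by apply: nonnegZ => //; exact: ltW.
apply/eqP; rewrite eq_le w_le_scale //=; last by move=> i; rewrite subrr mxE.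
rewrite -ler_pdivlMl //; apply: w_le_scale => //; first by rewrite invr_gt0.
by rewrite scalerA mulVf ?gt_eqF // scale1r => i; rewrite subrr mxE.
Qed.

Lemma sumw_ge0 x S : systems x S -> 0 <= \sum_(y <- S) w Q y.
Proof. by case=> S0 _; rewrite big_seq; apply: sumr_ge0 => y /S0; exact: w_ge0. Qed.

Lemma wstar_le_sys x S : systems x S -> wstar Q x <= \sum_(y <- S) w Q y.
Proof.
move=> Sx; apply: ge_inf; last by exists S.
by exists 0 => _ [S' S'x <-]; exact: sumw_ge0 S'x.
Qed.

Lemma systems1 x : nonnegv x -> systems x [:: x].
Proof. by move=> x0; split=> [y|]; rewrite ?big_seq1 // inE => /eqP->. Qed.

Lemma wstar_ge x (c : R) : nonnegv x ->
  (forall S, systems x S -> c <= \sum_(y <- S) w Q y) -> c <= wstar Q x.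
Proof.
move=> x0 h; apply: lb_le_inf => [|_ [S Sx <-]]; last exact: h.
by exists (\sum_(y <- [:: x]) w Q y); exists [:: x] => //; exact: systems1.
Qed.

Lemma wstar_ge0 x : nonnegv x -> 0 <= wstar Q x.
Proof. by move=> x0; apply: wstar_ge => // S /sumw_ge0. Qed.

Lemma wstar_adherent x (e : R) : nonnegv x -> 0 < e ->
  exists2 S, systems x S & \sum_(y <- S) w Q y < wstar Q x + e.
Proof.
move=> x0 e0.
have [|_ [S Sx <-] h] := @inf_adherent _
    [set \sum_(y <- S) w Q y | S in systems x]%classic _ e0.
  split.
    by exists (\sum_(y <- [:: x]) w Q y); exists [:: x] => //; exact: systems1.
  by exists 0 => _ [S' S'x <-]; exact: sumw_ge0 S'x.
by exists S.
Qed.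

Lemma wstar_le_w x : nonnegv x -> wstar Q x <= w Q x.
Proof. by move=> x0; have := wstar_le_sys (systems1 x0); rewrite big_seq1. Qed.

Lemma wstar_le_fam (I : finType) x (X : I -> 'cV[R]_k) :
  (forall t, nonnegv (X t)) -> \sum_t X t = x ->
  wstar Q x <= \sum_t w Q (X t).
Proof.
move=> X0 Xx; have := @wstar_le_sys x (map X (index_enum I)).
rewrite big_map; apply; split; last by rewrite big_map.
by move=> y /mapP[t _ ->].
Qed.

Lemma wstar_le_scale x x' (s : R) : nonnegv x -> nonnegv x' -> 0 < s ->
  preceqv x' (s *: x) -> wstar Q x' <= s * wstar Q x.
Proof.
move=> x0 x'0 s0 /preceqP x'x.
rewrite -ler_pdivrMl //; apply: wstar_ge => // S [S0 Sx].
rewrite ler_pdivrMl // mulr_sumr.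
(* Shrink the [i]-th coordinates of [s *: S] by the factor [x'_i / (s x_i)]. *)
pose f y : 'cV[R]_k := \col_i (x' i 0 / x i 0 * y i 0).
have fS0 y : y \in S -> nonnegv (f y).
  by move=> yS i; rewrite mxE mulr_ge0 ?divr_ge0 //; exact: S0.
apply: (@le_trans _ _ (\sum_(y <- S) w Q (f y))).
  have := @wstar_le_sys x' (map f S); rewrite big_map; apply; split.
    by move=> _ /mapP[y yS ->]; exact: fS0.
  apply/matrixP => i j; rewrite ord1 big_map summxE.
  under eq_bigr do rewrite mxE.
  (* Where [x i 0] vanishes, so does [x' i 0], and the default value of the quotient is harmless. *)
  rewrite -mulr_sumr -summxE Sx; have [xi|xi] := eqVneq (x i 0) 0.
    have := x'x i; rewrite mxE xi mulr0 => h.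
    by rewrite mulr0; apply/eqP; rewrite eq_le h x'0.
  by rewrite divfK.
rewrite big_seq [leRHS]big_seq; apply: ler_sum => y yS.
apply: w_le_scale => //; [exact: S0 | exact: fS0 |].
apply/preceqP => i; rewrite !mxE ler_wpM2r //; first exact: S0.
have [xi|xi] := eqVneq (x i 0) 0; first by rewrite xi invr0 mulr0 ltW.
rewrite ler_pdivrMr; first by have := x'x i; rewrite mxE.
by rewrite lt_def xi x0.
Qed.

Lemma wstarZ (s : R) x : nonnegv x -> 0 < s -> wstar Q (s *: x) = s * wstar Q x.
Proof.
move=> x0 s0; have sx0 : nonnegv (s *: x) by apply: nonnegZ => //; exact: ltW.
apply/eqP; rewrite eq_le wstar_le_scale //=; last by move=> i; rewrite subrr mxE.
rewrite -ler_pdivlMl //; apply: wstar_le_scale => //; first by rewrite invr_gt0.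
by rewrite scalerA mulVf ?gt_eqF // scale1r => i; rewrite subrr mxE.
Qed.

(** Concatenating systems for [x] and [x'] gives a system for [x + x']. *)
Lemma wstarD x x' : nonnegv x -> nonnegv x' ->
  wstar Q (x + x') <= wstar Q x + wstar Q x'.
Proof.
move=> x0 x'0; rewrite -lerBlDr; apply: wstar_ge => // S [S0 Sx].
rewrite lerBlDr -lerBlDl; apply: wstar_ge => // S' [S'0 S'x].
rewrite lerBlDl -big_cat; apply: wstar_le_sys; split; last by rewrite big_cat /= Sx S'x.
by move=> y; rewrite mem_cat => /orP[/S0|/S'0].
Qed.

(** * Equality of [w] and [wstar] under conditional positivity *)

Section ConditionallyPositive.
Hypothesis Qpos : forall y, \sum_i y i 0 = 0 -> 0 <= qform Q y.

(** The vector [norm1 v *: u - norm1 u *: v] has coordinate sum zero. For nonzero [u] and [v],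
    dividing the nonnegative value of its form by [norm1 u * norm1 v] yields the claim. *)
Lemma qratioD u v : nonnegv u -> nonnegv v ->
  qratio Q (u + v) <= qratio Q u + qratio Q v.
Proof.
move=> u0 v0.
have [->|un] := eqVneq u 0; first by rewrite add0r lerDr qratio_ge0 //; exact: nonneg0.
have [->|vn] := eqVneq v 0; first by rewrite addr0 lerDl qratio_ge0 //; exact: nonneg0.
have n0 : 0 < norm1 u by rewrite lt_def norm1_eq0 un norm1_ge0.
have m0 : 0 < norm1 v by rewrite lt_def norm1_eq0 vn norm1_ge0.
have a0 := qratio_ge0 Qge0 u0; have b0 := qratio_ge0 Qge0 v0.
rewrite qratio_le ?addr_ge0 // norm1D //.
have : 0 <= qform Q (norm1 v *: u + (- norm1 u) *: v).
  apply: Qpos; under eq_bigr do rewrite !mxE.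
  by rewrite big_split -!mulr_sumr -!norm1_nonneg //= mulrC mulNr subrr.
rewrite -[u in qform Q (u + v)]scale1r -[v in qform Q (_ + v)]scale1r !qform_lin.
rewrite -!qratioM; move: (qratio Q (u - v) * _) => d.
move: (qratio Q u) (qratio Q v) (norm1 u) (norm1 v) a0 b0 n0 m0.
move=> a b n m a0 b0 n0 m0 h.
suff : 0 <= m * a + n * b - (a * n + b * m - d) by lra.
by rewrite -(pmulr_rge0 _ (mulr_gt0 m0 n0)); lra.
Qed.

(** An optimal vertex for [u + v] splits into the restrictions of [u] and [v] to the same
    coordinates. *)
Lemma wD u v : nonnegv u -> nonnegv v -> w Q (u + v) <= w Q u + w Q v.
Proof.
move=> u0 v0; have [[A ->] _] := w_vertex (nonnegD u0 v0).
have Au0 := restr_nonneg A u0; have Av0 := restr_nonneg A v0.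
rewrite restrD (le_trans (qratioD Au0 Av0)) // lerD //.
  by apply: qratio_le_w => //; exact: restr_le.
by apply: qratio_le_w => //; exact: restr_le.
Qed.

Lemma w_eq_wstar x : nonnegv x -> w Q x = wstar Q x.
Proof.
move=> x0; apply/eqP; rewrite eq_le wstar_le_w // andbT.
apply: wstar_ge => // S [S0 <-]; elim: S S0 => [|y S IHS] S0.
  by rewrite !big_nil w0.
rewrite !big_cons; have y0 := S0 y (mem_head _ _).
have {}S0 z : z \in S -> nonnegv z by move=> zS; apply: S0; rewrite inE zS orbT.
apply: le_trans (wD y0 _) _; last by rewrite lerD2l IHS.
by rewrite big_seq; exact: nonneg_sum.
Qed.

End ConditionallyPositive.

(** * Bounds on [wstar] by the diagonal of [Q] *)

Lemma w_singleton x i : nonnegv x -> w Q (restr [set i]%SET x) <= x i 0 * Q i i.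
Proof.
move=> x0; have [[A ->] _] := w_vertex (restr_nonneg [set i]%SET x0).
set z := restr A _.
have z0 : nonnegv z by do 2 apply: restr_nonneg.
have zi j : j != i -> z j 0 = 0.
  by move=> ji; rewrite !mxE inE (negPf ji) if_same.
have zix : z i 0 <= x i 0 by rewrite !mxE inE eqxx; case: ifP.
rewrite qratio_le ?mulr_ge0 // norm1_nonneg // qformE.
rewrite (bigD1 i) //= [X in _ + X]big1 => [|j /zi zj]; last first.
  by apply: big1 => l _; rewrite zj !mul0r.
rewrite (bigD1 i) //= big1 => [|j /zi zj]; last by rewrite zj mulr0.
rewrite [X in _ <= _ * X](bigD1 i) //= big1 ?addr0 => [|j /zi //].
by rewrite ler_wpM2r // ler_wpM2r.
Qed.

(** Split [x] into its components along the coordinate axes. *)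
Lemma wstar_le_diag x : nonnegv x -> wstar Q x <= \sum_i x i 0 * Q i i.
Proof.
move=> x0; apply: (@le_trans _ _ (\sum_i w Q (restr [set i]%SET x))).
  apply: wstar_le_fam => [i|]; first exact: restr_nonneg.
  apply/matrixP => i j; rewrite ord1 summxE (bigD1 i) //= big1 => [|l li].
    by rewrite mxE inE eqxx addr0.
  by rewrite mxE inE eq_sym (negPf li).
by apply: ler_sum => i _; exact: w_singleton.
Qed.

Lemma diag_le_qstar i : Q i i <= qstar Q.
Proof. exact: (le_bigmax _ (fun i => Q i i)). Qed.

Lemma sum_diag_le : \sum_i Q i i <= k%:R * qstar Q.
Proof.
rewrite mulr_natl -[X in _ *+ X]card_ord -sumr_const.
by apply: ler_sum => i _; exact: diag_le_qstar.
Qed.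

(** Multiplying by the norm hides the special value of [qhat] at [0]. *)
Lemma qhatM x : nonnegv x -> qhat Q x * norm1 x = \sum_i x i 0 * Q i i.
Proof.
move=> x0; rewrite /qhat; case: eqVneq => [->|xn].
  have /eqP -> : norm1 (0 : 'cV[R]_k) == 0 by rewrite norm1_eq0.
  by rewrite mulr0 big1 // => i _; rewrite mxE mul0r.
by rewrite divfK ?norm1_eq0.
Qed.

Lemma qhat_le x : nonnegv x -> qhat Q x * norm1 x <= qstar Q * norm1 x.
Proof.
move=> x0; rewrite qhatM // norm1_nonneg // mulr_sumr; apply: ler_sum => i _.
by rewrite mulrC ler_wpM2r // diag_le_qstar.
Qed.

(* [\sum_i q_ii (y_i - t)^2 >= 0] for [t = c * norm1 y / \sum_i q_ii]. *)
Lemma w_ge_linear (c : R) y : nonnegv y -> 0 < \sum_i Q i i ->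
  (2 * c * (\sum_i y i 0 * Q i i) - c ^+ 2 * norm1 y) / (\sum_i Q i i) <= w Q y.
Proof.
move=> y0; set T := \sum_i Q i i; set L := \sum_i _ => T0.
apply: le_trans (qratio_le_w y0 _); last by move=> i; rewrite subrr mxE.
have [yE|yn] := eqVneq y 0.
  have -> : L = 0 by apply: big1 => i _; rewrite yE mxE mul0r.
  have /eqP -> : norm1 y == 0 by rewrite norm1_eq0 yE.
  by rewrite !mulr0 subr0 mul0r qratio_ge0.
have n0 : 0 < norm1 y by rewrite lt_def norm1_eq0 yn norm1_ge0.
rewrite ler_pdivlMr // mulrAC ler_pdivrMr //.
(* The off-diagonal terms are nonnegative and are dropped. *)
have diag : \sum_i y i 0 ^+ 2 * Q i i <= qform Q y.
  rewrite qformE; apply: ler_sum => i _; rewrite (bigD1 i) //= -[leLHS]addr0.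
  apply: lerD; first by rewrite expr2 mulrAC.
  by apply: sumr_ge0 => j _; rewrite !mulr_ge0.
apply: le_trans (ler_wpM2r (ltW T0) diag).
pose t := c * norm1 y / T.
have tT : t * T = c * norm1 y by rewrite /t divfK // gt_eqF.
have : 0 <= \sum_i Q i i * (y i 0 - t) ^+ 2.
  by apply: sumr_ge0 => i _; rewrite mulr_ge0 ?sqr_ge0.
have -> : \sum_i Q i i * (y i 0 - t) ^+ 2 =
    \sum_i y i 0 ^+ 2 * Q i i - 2 * t * L + t ^+ 2 * T.
  rewrite !mulr_sumr -sumrB -big_split; apply: eq_bigr => i _ /=.
  by move: (y i 0) (Q i i) => yi q; clearbody t; lra.
move=> /(mulr_ge0 (ltW T0)); move: (\sum_i _ * Q i i) (norm1 y) tT => D n.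
clearbody t T L => tT h.
(* After substituting [t * T] for [c * norm1 y], the claim is [T] times the expanded sum of
   squares. *)
have -> : (2 * c * L - c ^+ 2 * n) * n = 2 * (t * T) * L - (t * T) ^+ 2.
  by rewrite tT; lra.
by clear tT; lra.
Qed.

(** The bound of [w_ge_linear] is linear in [y], so its sum over a system depends only on [x]. The
    choice [c = qhat Q x] maximises that sum. *)
Lemma wstar_ge_qhat x : nonnegv x -> 0 < \sum_i Q i i ->
  qhat Q x ^+ 2 / (\sum_i Q i i) * norm1 x <= wstar Q x.
Proof.
move=> x0 T0; apply: wstar_ge => // S [S0 Sx].
set c := qhat Q x; set T := \sum_i Q i i in T0 *.
apply: (@le_trans _ _ (\sum_(y <- S)
  (2 * c * (\sum_i y i 0 * Q i i) - c ^+ 2 * norm1 y) / T)); last first.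
  by rewrite big_seq [leRHS]big_seq; apply: ler_sum => y /S0 y0; exact: w_ge_linear.
rewrite -mulr_suml sumrB -!mulr_sumr.
have -> : \sum_(y <- S) \sum_i y i 0 * Q i i = c * norm1 x.
  rewrite exchange_big qhatM //=; apply: eq_bigr => i _.
  by rewrite -mulr_suml -summxE Sx.
have -> : \sum_(y <- S) norm1 y = norm1 x.
  rewrite big_seq (eq_bigr (fun y => \sum_i y i 0)) => [|y /S0/norm1_nonneg //].
  rewrite -big_seq exchange_big norm1_nonneg //=; apply: eq_bigr => i _.
  by rewrite -summxE Sx.
by rewrite mulrAC ler_pM2r ?invr_gt0 //; lra.
Qed.

(** * Optimal systems of [k] vectors *)

(** Move the family along a linear relation [d] between its vectors, in a direction that does not
    increase the total of [w], until one coefficient reaches zero. *)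
Lemma drop_vector n (X : 'I_n.+1 -> 'cV[R]_k) : (k <= n)%N ->
  (forall t, nonnegv (X t)) ->
  exists Y : 'I_n -> 'cV[R]_k, [/\ forall t, nonnegv (Y t),
    \sum_t Y t = \sum_t X t & \sum_t w Q (Y t) <= \sum_t w Q (X t)].
Proof.
move=> kn X0; pose M : 'M[R]_(n.+1, k) := \matrix_(t, i) X t i 0.
have [c cM c0] : exists2 c : 'rV[R]_n.+1, c *m M = 0 & c != 0.
  have : kermx M != 0.
    by rewrite -mxrank_eq0 mxrank_ker subn_eq0 -ltnNge ltnS
      (leq_trans (rank_leq_col M)).
  by case/rowV0Pn => c /sub_kermxP cM c0; exists c.
(* The sign of [c] is chosen to make the weighted sum of [w] nonpositive. If it is negative, some
   coefficient is negative since [w] is nonnegative; if it is zero, both signs are allowed. *)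
have [d [dX dw [j dj]]] : exists d : 'I_n.+1 -> R,
    [/\ \sum_t d t *: X t = 0, \sum_t d t * w Q (X t) <= 0 & exists j, d j < 0].
  have cX : \sum_t c 0 t *: X t = 0.
    apply/matrixP => i j; rewrite ord1 summxE mxE.
    have := congr1 (fun N : 'rV_k => N 0 i) cM; rewrite !mxE => cMi.
    by rewrite -[RHS]cMi; apply: eq_bigr => t _; rewrite !mxE.
  have cNX : \sum_t (- c 0 t) *: X t = 0.
    by under eq_bigr do rewrite scaleNr; rewrite sumrN cX oppr0.
  have cNw : \sum_t (- c 0 t) * w Q (X t) = - \sum_t c 0 t * w Q (X t).
    by rewrite -sumrN; apply: eq_bigr => t _; rewrite mulNr.
  have neg (d : 'I_n.+1 -> R) : \sum_t d t * w Q (X t) < 0 -> exists j, d j < 0.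
    move=> dw; apply: contrapT => /forallNP d0; move: dw; apply/negP.
    rewrite -leNgt; apply: sumr_ge0 => t _; rewrite mulr_ge0 ?w_ge0 //.
    by rewrite leNgt; apply/negP.
  have [cw|cw|cw] := ltgtP (\sum_t c 0 t * w Q (X t)) 0.
  - by exists (c 0); split; rewrite ?ltW //; exact: neg.
  - exists (fun t => - c 0 t); split; rewrite ?cNw ?oppr_le0 ?ltW //.
    by apply: neg; rewrite cNw oppr_lt0.
  - have [j cj] : exists j, c 0 j != 0 by case/rV0Pn: c0 => j cj; exists j.
    have [cj0|cj0|/eqP] := ltgtP (c 0 j) 0; last by rewrite (negPf cj).
      by exists (c 0); split; rewrite ?cw //; exists j.
    exists (fun t => - c 0 t); split; rewrite ?cNw ?cw ?oppr0 //.
    by exists j; rewrite oppr_lt0.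
have [m _ mmin] := @arg_minP _ _ _ j predT d isT.
have dm : d m < 0 by apply: le_lt_trans dj; exact: mmin.
(* Since [d m] is the most negative coefficient, every [a t] is nonnegative, and [a m = 0] removes
   [X m]. *)
pose a t := 1 - d t / d m.
have a0 t : 0 <= a t.
  by rewrite subr_ge0 ler_ndivrMr // mul1r; exact: mmin.
have am : a m = 0 by rewrite /a divff ?subrr // lt_eqF.
exists (fun t => a (lift m t) *: X (lift m t)); split=> [t||].
- exact: nonnegZ.
- have := @bigD1_ord _ +%R 0 _ m predT (fun t => a t *: X t) isT.
  rewrite /= am scale0r add0r => <-.
  under eq_bigr do rewrite scalerBl scale1r mulrC -scalerA.
  by rewrite sumrB -scaler_sumr dX scaler0 subr0.
- have := @bigD1_ord _ +%R 0 _ m predT (fun t => a t * w Q (X t)) isT.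
  rewrite /= am mul0r add0r.
  under [in X in _ -> X <= _]eq_bigr do rewrite wZ //.
  move=> <-; under eq_bigr do rewrite mulrBl mul1r mulrAC.
  rewrite sumrB -mulr_suml lerBlDr lerDl.
  by rewrite mulr_le0 // invr_le0 ltW.
Qed.

(** The default of [nth] pads a short system with zero vectors, which contribute nothing. *)
Lemma sum_nth_pad (V : nmodType) (F : 'cV[R]_k -> V) S n : F 0 = 0 ->
  (size S <= n)%N -> \sum_(t < n) F (nth 0 S t) = \sum_(y <- S) F y.
Proof.
move=> F0 Sn; rewrite (big_nth 0) big_mkord.
rewrite (big_ord_widen n (fun t => F (nth 0 S t)) Sn) [RHS]big_mkcond.
by apply: eq_bigr => t _; case: ltnP => // St; rewrite nth_default.
Qed.

(* Caratheodory's theorem for the positively homogeneous function [w]. *)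
Lemma reduce_system x S : systems x S ->
  exists Y : 'I_k -> 'cV[R]_k, [/\ forall t, nonnegv (Y t),
    \sum_t Y t = x & \sum_t w Q (Y t) <= \sum_(y <- S) w Q y].
Proof.
have [n] := ubnP (size S); elim: n S => // n IHn S; rewrite ltnS => Sn [S0 Sx].
have S0' t : nonnegv (nth 0 S t).
  have [tS|St] := ltnP t (size S); first by apply: S0; rewrite mem_nth.
  by rewrite nth_default //; exact: nonneg0.
have [Sk|kS] := leqP (size S) k.
  exists (fun t => nth 0 S t); split=> //.
    by rewrite (sum_nth_pad (F := id)).
  by rewrite sum_nth_pad // w0.
have SE : (size S).-1.+1 = size S by rewrite prednK // (leq_ltn_trans _ kS).
have [||Y [Y0 YX Yw]] := @drop_vector (size S).-1 (fun t => nth 0 S t).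
- by rewrite -ltnS SE.
- by move=> t; exact: S0'.
have [||Z [Z0 Zx Zw]] := IHn [seq Y t | t <- enum 'I_(size S).-1].
- by rewrite size_map size_enum_ord SE.
- split; first by move=> y /mapP[t _ ->].
  by rewrite big_map big_enum YX (sum_nth_pad (F := id)) ?SE.
exists Z; split=> //; apply: le_trans Zw _.
rewrite big_map big_enum; apply: le_trans Yw _.
by rewrite sum_nth_pad ?w0 ?SE.
Qed.
(* Lower semicontinuity of [w] comes from [w_le_scale]: if [f] is close to [p],
   then [s p <= f] for a given [s < 1], also where [p] vanishes. *)
Lemma wstar_attained x : nonnegv x -> exists X : 'I_k -> 'cV[R]_k,
  [/\ forall t, nonnegv (X t), \sum_t X t = x & \sum_t w Q (X t) = wstar Q x].
Proof.
(* The [k] vectors are encoded by their [k * k] entries, a point of a box. *)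
move=> x0; pose X (f : 'I_k * 'I_k -> R) t : 'cV[R]_k := \col_i f (t, i).
pose P e f := \sum_t X f t = x /\ \sum_t w Q (X f t) <= wstar Q x + e.
have [||p hp] := @box_approx R _ (fun j => x j.2 0) P.
- by move=> e e' f ee' [fx fw]; split=> //; apply: le_trans fw _; rewrite lerD2l.
- move=> e e0; have [S /reduce_system[Y [Y0 Yx Yw]] Se] := wstar_adherent x0 e0.
  have YE t : X (fun j => Y j.1 j.2 0) t = Y t.
    by apply/matrixP => i j; rewrite ord1 mxE.
  exists (fun j => Y j.1 j.2 0).
    split; first by rewrite -Yx; apply: eq_bigr => t _.
    by under eq_bigr do rewrite YE; exact: le_trans Yw (ltW Se).
  case=> t i /=; rewrite Y0 -Yx summxE (bigD1 t) //= lerDl.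
  by apply: sumr_ge0 => j _; exact: Y0.
have p0 j : 0 <= p j.
  rewrite leNgt; apply/negP => pj; have [|f [_ f0 /(_ j)]] := hp (- p j).
    by rewrite oppr_gt0.
  by rewrite ltr_norml opprK => /andP[]; have := f0 j; lra.
have X0 t : nonnegv (X p t) by move=> i; rewrite mxE.
have Xx : \sum_t X p t = x.
  apply/matrixP => i j; rewrite ord1 {j}; apply/eqP; rewrite -subr_eq0 -normr_eq0.
  rewrite eq_le normr_ge0 andbT leNgt; apply/negP => d0.
  set d := `|_| in d0.
  (* Each coordinate collects [k] errors below [d / k.+1], which cannot add up to [d]. *)
  have [|f [[fx _] _ fp]] := hp (d / k.+1%:R); first by rewrite divr_gt0.
  suff : d <= d / k.+1%:R * k%:R.
    by rewrite mulrAC ler_pdivlMr // ler_pM2l // ler_nat ltnn.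
  rewrite {1}/d -fx !summxE -sumrB (le_trans (ler_norm_sum _ _ _)) //.
  rewrite mulr_natr -[X in _ *+ X]card_ord -sumr_const; apply: ler_sum => t _.
  by rewrite !mxE ltW.
exists (X p); split=> //; apply/eqP; rewrite eq_le wstar_le_fam // andbT.
rewrite leNgt; apply/negP; set W := \sum_t _; set v := wstar Q x => vW.
have v0 : 0 <= v by exact: wstar_ge0.
have W0 : 0 < W by exact: le_lt_trans vW.
(* Chosen so that [s * W] is the midpoint of [v] and [W]. *)
pose s := (v + W) / (2 * W).
have sW : s * W = (v + W) / 2 by rewrite /s invfM mulrA divfK // gt_eqF.
have s0 : 0 < s by rewrite divr_gt0 // ?mulr_gt0 // ltr_wpDl.
have s1 : s < 1 by rewrite ltr_pdivrMr ?mulr_gt0 //; lra.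
(* The term [(W - v) / 4] keeps [v + e] below [s * W]; the others force [s * p j <= f j] wherever
   [p j] is positive. *)
pose e := \big[Num.min/(W - v) / 4]_(j | 0 < p j) ((1 - s) * p j).
have e0 : 0 < e.
  apply: lt_bigmin => [|j pj]; first by rewrite divr_gt0 // subr_gt0.
  by rewrite mulr_gt0 // subr_gt0.
have eW : e <= (W - v) / 4 by exact: bigmin_le_id.
have [f [[fx fw] f0 fp]] := hp e e0.
have : s * W <= \sum_t w Q (X f t).
  rewrite mulr_sumr; apply: ler_sum => t _.
  rewrite -(wZ (X0 t) (ltW s0)); apply: w_le.
    by apply: nonnegZ => //; exact: ltW.
  apply/preceqP => i; rewrite !mxE.
  have := p0 (t, i); rewrite le_eqVlt => /predU1P[<-|pj]; first by rewrite mulr0.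
  have : e <= (1 - s) * p (t, i) by apply: bigmin_le_cond.
  have := fp (t, i); rewrite ltr_norml => /andP[_].
  by clear; clearbody s e; lra.
rewrite sW; move: fw; rewrite -/v; clear -eW vW; clearbody v W e.
by move: (\sum_t _) => u; lra.
Qed.

(** * Integral systems *)

(** Greedy choice: the first index takes as much of [m] as it can, and the others share the rest. *)
Lemma nat_shrink n (a : 'I_n -> nat) m : (m <= \sum_t a t)%N ->
  exists2 b : 'I_n -> nat, (forall t, b t <= a t)%N & (\sum_t b t)%N = m.
Proof.
elim: n a m => [|n IHn] a m.
  by rewrite big_ord0 leqn0 => /eqP ->; exists a => //; rewrite big_ord0.
rewrite big_ord_recl => am.
have [|b ba bm] := IHn (fun t => a (lift ord0 t)) (m - a ord0)%N.
  by rewrite leq_subLR.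
exists (fun t => if unlift ord0 t is Some j then b j else minn m (a ord0)).
  by move=> t; case: unliftP => [j|] ->; rewrite ?ba ?geq_minr.
rewrite big_ord_recl unlift_none.
under eq_bigr do rewrite liftK.
by rewrite bm minnE subnK // leq_subr.
Qed.

(* Decompose [x + k (1, ..., 1)] instead of [x]: the surplus pays for rounding
   down, and costs at most [k \sum_i q_ii]. *)
Lemma wstar_integral x : natv x -> exists X : 'I_k -> 'cV[R]_k,
  [/\ forall t, natv (X t), \sum_t X t = x &
      \sum_t w Q (X t) <= wstar Q x + k%:R ^+ 2 * qstar Q].
Proof.
move=> xn; have x0 : nonnegv x by move=> i; exact: natr_ge0.
pose one : 'cV[R]_k := const_mx k%:R.
have one0 : nonnegv one by move=> i; rewrite mxE.
have [X [X0 Xx Xw]] := wstar_attained (nonnegD x0 one0).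
have Xtr t i := truncn_itv (X0 t i).
have ex i : exists b : 'I_k -> nat,
    (forall t, (b t)%:R <= X t i 0) /\ x i 0 = (\sum_t b t)%:R.
  have /natrP[m xm] := xn i.
  (* Rounding down loses less than 1 in each of [k] vectors, so the surplus [k] keeps the rounded
     sum at least [m]; [nat_shrink] then lowers it to exactly [m]. *)
  have [|b bX bm] := @nat_shrink _ (fun t => Num.truncn (X t i 0)) m.
    have := congr1 (fun z : 'cV[R]_k => z i 0) Xx; rewrite summxE !mxE xm => E.
    rewrite -(ler_nat R) -(lerD2r k%:R) -E natr_sum.
    rewrite -[X in _ + X%:R]card_ord -sumr_const -big_split; apply: ler_sum => t _.
    by have /andP[_ /ltW] := Xtr t i; rewrite -natr1.
  exists b; split; last by rewrite bm xm.
  by move=> t; have /andP[+ _] := Xtr t i; apply: le_trans; rewrite ler_nat.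
have [b hb] := choice ex.
exists (fun t => \col_i (b i t)%:R); split.
- by move=> t i; rewrite mxE natr_nat.
- apply/matrixP => i j; rewrite ord1 summxE (hb i).2 natr_sum.
  by apply: eq_bigr => t _; rewrite mxE.
apply: (@le_trans _ _ (wstar Q (x + one))).
  rewrite -Xw; apply: ler_sum => t _; apply: w_le; first by move=> i; rewrite mxE.
  by apply/preceqP => i; rewrite mxE; exact: (hb i).1.
apply: le_trans (wstarD x0 one0) _; rewrite lerD2l.
apply: le_trans (wstar_le_diag one0) _.
under eq_bigr do rewrite mxE.
by rewrite -mulr_sumr expr2 -mulrA ler_wpM2l // sum_diag_le.
Qed.

End W.

Theorem theorem2p6 (R : realType) (k : nat) (Q : 'M[R]_k) (x : 'cV[R]_k)
    (Qsym : Q^T = Q) (Qge0 : forall i j, 0 <= Q i j) (xge0 : nonnegv x) :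
  (* (a) *)
  ((forall (x' : 'cV[R]_k) (s : R),
      nonnegv x' -> 0 < s -> preceqv x' (s *: x) ->
      w Q x' <= s * w Q x /\ wstar Q x' <= s * wstar Q x) /\
   (forall s : R, 0 < s ->
      w Q (s *: x) = s * w Q x /\ wstar Q (s *: x) = s * wstar Q x)) /\
  (* (b) *)
  (exists z : 'cV[R]_k,
      (forall i, z i 0 = 0 \/ z i 0 = x i 0) /\ qratio Q z = w Q x) /\
  (* (c) *)
  ((forall y : 'cV[R]_k, \sum_i y i 0 = 0 -> 0 <= qform Q y) ->
      w Q x = wstar Q x) /\
  (* (d) *)
  ((qstar Q * norm1 x >= qhat Q x * norm1 x /\
    qhat Q x * norm1 x >= wstar Q x) /\
   (0 < qstar Q ->
      wstar Q x >= qhat Q x ^+ 2 / (\sum_i Q i i) * norm1 x /\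
      qhat Q x ^+ 2 / (\sum_i Q i i) * norm1 x >=
        qhat Q x ^+ 2 / (k%:R * qstar Q) * norm1 x)) /\
  (* (e) *)
  (forall x' : 'cV[R]_k, nonnegv x' ->
      wstar Q x + wstar Q x' >= wstar Q (x + x')) /\
  (* (f) *)
  (exists X : 'I_k -> 'cV[R]_k,
      (forall t, nonnegv (X t)) /\
      \sum_t X t = x /\ \sum_t w Q (X t) = wstar Q x) /\
  (* (g) *)
  (natv x -> exists X : 'I_k -> 'cV[R]_k,
      (forall t, natv (X t)) /\
      \sum_t X t = x /\
      \sum_t w Q (X t) <= wstar Q x + k%:R ^+ 2 * qstar Q).
Proof.
split.
  split=> [x' s x'0 s0 x'x | s s0].
    by split; [exact: w_le_scale | exact: wstar_le_scale].
  by split; [apply: wZ => //; exact: ltW | exact: wstarZ].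
split.
  have [[A wA] _] := w_vertex Qge0 xge0; exists (restr A x); split=> // i.
  by rewrite mxE; case: ifP; [right | left].
split; first by move=> Qpos; exact: w_eq_wstar.
split.
  split; first by split; [exact: qhat_le | rewrite qhatM //; exact: wstar_le_diag].
  (* If the trace vanished, so would every diagonal entry, and with them [qstar Q]. *)
  move=> q0; have T0 : 0 < \sum_i Q i i.
    rewrite lt_def sumr_ge0 // andbT; apply/eqP => T0.
    have Qii i : Q i i = 0.
      by apply/eqP; move/eqP: T0; rewrite psumr_eq0 // => /allP/(_ i (mem_index_enum i)).
    by move: q0; rewrite ltNge bigmax_le // => i _; rewrite Qii.
  split; first exact: wstar_ge_qhat.
  rewrite ler_wpM2r ?norm1_ge0 // ler_wpM2l ?sqr_ge0 // lef_pV2 ?posrE //.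
    exact: sum_diag_le.
  exact: lt_le_trans T0 (sum_diag_le _).
split; first by move=> x' x'0; exact: wstarD.
split.
  by have [X [X0 Xx Xw]] := wstar_attained Qge0 xge0; exists X.
by move=> xn; have [X [Xn Xx Xw]] := wstar_integral Qge0 xn; exists X.
Qed.
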